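(* Let $m$ be a positive integer, let $\mathcal{V}$ be any set of prime numbers each of which is coprime to $m$ and does not exceed $m^{1/2}$, and let $S$ and $L$ be any integers with $0<L\le m$. Let $J$ denote the number of solutions $(v_1,v_2,y_1,y_2)$ of the congruence $$v_1y_1\equiv v_2y_2\pmod m,\qquad v_1,v_2\in\mathcal{V},\qquad S+1\le y_1,y_2\le S+L,$$ with $y_1,y_2$ integers. Then $$J=\frac{|\mathcal{V}|^2L^2}{m}+|\mathcal{V}|L-\frac{|\mathcal{V}|L^2}{m}+O\left(\frac{m^2\log^2 m}{\phi(m)}\right).$$
   Context: $|\mathcal{V}|$ is the number of elements of $\mathcal{V}$ and $\phi$ is Euler's totient function. The constant implied by $O$ is absolute (uniform in $m,\mathcal{V},S,L$). *)

(* Defs.v *)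
From mathcomp Require Import all_boot all_order all_algebra.
From mathcomp Require Import finmap.
From mathcomp Require Import all_classical all_reals all_analysis.

Set Implicit Arguments.
Unset Strict Implicit.
Unset Printing Implicit Defensive.

Import Order.TTheory GRing.Theory Num.Theory.

Local Open Scope classical_set_scope.
Local Open Scope ring_scope.

Definition solutions (m : nat) (V : {fset nat}) (S L : int) :
    set (nat * nat * int * int) :=
  [set q | let: (v1, v2, y1, y2) := q in
    [/\ v1 \in V, v2 \in V,
        S + 1 <= y1 <= S + L, S + 1 <= y2 <= S + L &
        (v1%:Z * y1 = v2%:Z * y2 %[mod m%:Z])%Z]].

(* [fset_set] is [fset0] on infinite sets; [solutions m V S L] is always
   finite, so this is its actual cardinality. *)
Definition nb_solutions (m : nat) (V : {fset nat}) (S L : int) : nat :=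
  #|` fset_set (solutions m V S L)|%fset.

(* Main.v *)
Require Import Defs.
From mathcomp Require Import all_boot all_order all_algebra cyclic.
From mathcomp Require Import finmap.
From mathcomp Require Import all_classical all_reals all_analysis.
From mathcomp Require Import complex zify ring lra.

Import Order.TTheory GRing.Theory Num.Theory.

Local Open Scope ring_scope.

(* Let |x| be the distance from x to the nearest multiple of m.  Pairs with
   v1 = v2 contribute L each, because L <= m.  For v1 <> v2, expanding the
   congruence in m-th roots of unity isolates the main term L^2/m and leaves
   at most 4m * sum_(0 < t < m) 1/(|t v1| |t v2|).  Group the triples
   (t, v1, v2) by the residues (x1, x2) of (t v1, t v2) and put
   g = gcd(x1, m) = gcd(x2, m).  Two triples with the same residues have
   v1 v2' - v1' v2 divisible by m/g, while this determinant is smaller than m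
   in absolute value; as the v's are primes, this leaves at most 2g triples
   per class.  Hence the total is at most a constant times
   m * sum_(d | m) d (sum_(d | x) 1/|x|)^2 << m log^2 m sum_(d | m) 1/d, and
   sum_(d | m) 1/d <= m/phi(m) follows from phi(m) <= d phi(m/d). *)

(** * Euler's totient and divisor sums *)

(** Cut [[0, d * k)] into [d] blocks of length [k]: a number coprime to [d * k] is coprime to [k],
    and by periodicity each block holds [totient k] numbers coprime to [k]. *)
Lemma totient_mul_le (d k : nat) : (totient (d * k) <= d * totient k)%N.
Proof.
rewrite !totient_count_coprime.
apply: (@leq_trans (\sum_(0 <= i < d * k) coprime k i)).
  by apply: leq_sum => i _; rewrite coprimeMl; case: (coprime d i).
rewrite big_nat_mul -[X in (_ <= X * _)%N]subn0 -sum_nat_const_nat.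
apply: leq_sum => i _.
rewrite -{1}[(i * k)%N]add0n big_addn mulSn addnK.
by apply: leq_sum => j _; rewrite /coprime addnC gcdnMDl.
Qed.

Lemma totient_dvd_le (e m : nat) :
  (e %| m)%N -> (e * totient m <= totient e * m)%N.
Proof.
case/dvdnP=> d ->; rewrite [(e * _)%N]mulnC mulnA leq_mul2r.
by rewrite [(totient e * _)%N]mulnC totient_mul_le orbT.
Qed.

(** Expand [m] as the sum of [totient e] over its divisors [e] and compare termwise. The summands
    [e / m] are the reciprocals of the complementary divisors. *)
Lemma sum_divisors_le (R : numFieldType) (m : nat) : (0 < m)%N ->
  \sum_(e < m.+1 | (e %| m)%N) (e%:R / m%:R : R) <= m%:R / (totient m)%:R.
Proof.
move=> m0.
have t0 : (0 : R) < (totient m)%:R by rewrite ltr0n totient_gt0.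
rewrite ler_pdivlMr // -[X in _ <= X%:R]sum_totient_dvd mulr_suml natr_sum.
apply: ler_sum => e em.
rewrite mulrAC ler_pdivrMr ?ltr0n // -!natrM ler_nat.
exact: totient_dvd_le.
Qed.

(** * Reciprocals of distances to the nearest multiple of [m] *)

Definition mod_dist (m x : nat) : nat := minn (x %% m) (m - x %% m).

Lemma mod_dist_mod (m x : nat) : mod_dist m (x %% m) = mod_dist m x.
Proof. by rewrite /mod_dist modn_mod. Qed.

Lemma mod_dist_gt0 (m x : nat) :
  (0 < m)%N -> (0 < mod_dist m x)%N = ~~ (m %| x)%N.
Proof.
by move=> m0; rewrite leq_min subn_gt0 ltn_mod m0 andbT /dvdn lt0n.
Qed.

Lemma sum_multiples (R : nmodType) (d k : nat) (F : nat -> R) : (0 < d)%N ->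
  \sum_(0 <= i < k * d | (d %| i)%N) F i = \sum_(0 <= j < k) F (j * d)%N.
Proof.
move=> d0; rewrite big_mkcond big_nat_mul; apply: eq_bigr => j _.
rewrite big_ltn; last by rewrite ltn_mul2r d0 ltnSn.
rewrite dvdn_mull // big_nat_cond big1 ?Monoid.mulm1 //.
move=> i; rewrite andbT => /andP[ji ij]; case: ifP => // /dvdnP[q qE].
by move: ji ij; rewrite qE !ltn_mul2r d0 /= ltnS => /leq_trans/[apply]; rewrite ltnn.
Qed.

Definition harmonic_sum (R : fieldType) (n : nat) : R :=
  \sum_(1 <= j < n.+1) j%:R^-1.

Lemma sum_inv_multiples_le (R : numFieldType) (m d : nat) : (0 < m)%N ->
  (d %| m)%N ->
  \sum_(1 <= x < m | (d %| x)%N) (x%:R^-1 : R) <= d%:R^-1 * harmonic_sum R m.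
Proof.
move=> m0 dm; have d0 := dvdn_gt0 m0 dm; case/dvdnP: dm => k mE.
have k0 : (0 < k)%N by move: m0; rewrite mE muln_gt0 => /andP[].
(* The index 0 can be added freely because [0^-1 = 0]. *)
have -> : \sum_(1 <= x < m | (d %| x)%N) (x%:R^-1 : R) =
          \sum_(0 <= x < k * d | (d %| x)%N) x%:R^-1.
  by rewrite -mE [RHS]big_mkcond [RHS]big_ltn // dvdn0 invr0 /= add0r -big_mkcond.
rewrite sum_multiples // big_ltn // mul0n invr0 add0r mulr_sumr.
rewrite [leRHS](big_cat_nat _ (n := k)) //=; last first.
  by rewrite mE ltnW // ltnS leq_pmulr.
rewrite (eq_bigr (fun j => d%:R^-1 * j%:R^-1 : R)); last first.
  by move=> i _; rewrite natrM invfM mulrC.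
by rewrite lerDl sumr_ge0.
Qed.

(** The smaller of [x] and [m - x] has its reciprocal below [1/x + 1/(m - x)]. The reflection
    [x -> m - x] preserves multiples of [d], so both halves obey the same bound. *)
Lemma sum_inv_mod_dist_le (R : realFieldType) (m d : nat) : (0 < m)%N ->
  (d %| m)%N ->
  \sum_(1 <= x < m | (d %| x)%N) ((mod_dist m x)%:R^-1 : R)
    <= 2 / d%:R * harmonic_sum R m.
Proof.
move=> m0 dm.
have split_le (x : nat) : (0 < x < m)%N ->
    ((mod_dist m x)%:R^-1 : R) <= x%:R^-1 + (m - x)%:R^-1.
  move=> /andP[x0 xm]; rewrite /mod_dist modn_small //.
  by case: leqP => _; rewrite ?lerDl ?lerDr invr_ge0.
apply: (@le_trans _ _
  (\sum_(1 <= x < m | (d %| x)%N) (x%:R^-1 + (m - x)%:R^-1 : R))).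
  by rewrite [leLHS]big_nat_cond [leRHS]big_nat_cond;
    apply: ler_sum => x /andP[/split_le].
rewrite big_split /= -mulrA mulr_natl mulr2n lerD ?sum_inv_multiples_le //.
rewrite big_nat_rev /= add1n.
apply: le_trans (@sum_inv_multiples_le R m d m0 dm).
rewrite le_eqVlt; apply/predU1P; left.
rewrite big_nat_cond [RHS]big_nat_cond; apply: eq_big => [x|x /andP[/andP[x0 xm] _]].
  case: (boolP (0 < x < m)%N) => //= /andP[x0 xm]; rewrite subSS.
  by rewrite dvdn_subr // ltnW.
by rewrite subSS subKn // ltnW.
Qed.

(** * Determinants and triples with prescribed residues *)

Lemma coprime_modMr_inj (m c a b : nat) : coprime m c ->
  a * c = b * c %[mod m] -> a = b %[mod m].
Proof.
move=> mc; wlog ab : a b / (a <= b)%N => [H /eqP E|].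
  by case: (leqP a b) => [|/ltnW] ab; [|apply: esym]; apply: H => //; apply/eqP;
    rewrite // eq_sym.
move/esym/eqP; rewrite eqn_mod_dvd ?leq_mul2r ?ab ?orbT // -mulnBl Gauss_dvdl //.
by rewrite -eqn_mod_dvd // => /eqP.
Qed.

Lemma dvdz_small_eq0 (d : nat) (z : int) :
  (d %| z)%Z -> (`|z| < d)%N -> z = 0.
Proof.
rewrite dvdzE /= => dz zd; apply/eqP; rewrite -absz_eq0 -leqn0 leqNgt.
by apply/negP => z0; have := dvdn_leq z0 dz; rewrite leqNgt zd.
Qed.

(** Modulo [p] the equation gives [p %| (a - a') * q], hence [p %| a - a']; two numbers in [[1, p]]
    differ by less than [p]. *)
Lemma det_primes_inj (p q a b a' b' : nat) :
  prime p -> prime q -> p != q -> (0 < a <= p)%N -> (0 < a' <= p)%N ->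
  p%:Z * b - a%:Z * q = p%:Z * b' - a'%:Z * q -> a = a' /\ b = b'.
Proof.
move=> pp qp pq ap ap' E.
have pd : (p %| (a%:Z - a'%:Z)%R)%Z.
  have cpq : coprimez p q.
    by change (coprime p q); rewrite prime_coprime // dvdn_prime2.
  rewrite -(Gauss_dvdzl _ cpq); apply/dvdzP; exists (b%:Z - b'%:Z).
  by rewrite mulrBl mulrBl; lia.
have : a%:Z - a'%:Z = 0 by apply: (dvdz_small_eq0 _ _ pd); lia.
move/eqP; rewrite subr_eq0 => /eqP[aa']; split=> //.
move: E; rewrite aa' => /addIr /eqP.
by rewrite -!PoszM eqz_nat eqn_pmul2l ?prime_gt0 // => /eqP.
Qed.

(** Modulo [m], [x1] times the determinant is [a * x2 * a' - a' * x2 * a = 0]. Dividing by the gcd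
    leaves a cofactor of [x1] coprime to [m %/ gcdn x1 m]. *)
Lemma det_dvd (m x1 x2 a b a' b' : nat) : (0 < m)%N ->
  x1 * b = x2 * a %[mod m] -> x1 * b' = x2 * a' %[mod m] ->
  ((m %/ gcdn x1 m)%N %| (a%:Z * b' - a'%:Z * b)%R)%Z.
Proof.
move=> m0 E E'.
have g0 : (0 < gcdn x1 m)%N by rewrite gcdn_gt0 m0 orbT.
have : (m %| x1 * `|(a%:Z * b' - a'%:Z * b)%R|)%N.
  have -> : (x1 * `|(a%:Z * b' - a'%:Z * b)%R|)%N =
            `|((x1 * (a * b'))%N%:Z - (x1 * (a' * b))%N%:Z)%R|%N.
    by rewrite !PoszM -mulrBr abszM.
  change (m%:Z %| ((x1 * (a * b'))%N%:Z - (x1 * (a' * b))%N%:Z)%R)%Z.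
  rewrite -eqz_mod_dvd !modz_nat; apply/eqP; congr Posz.
  apply: (@etrans _ _ ((a * (x2 * a')) %% m)%N).
    by rewrite mulnCA -modnMmr E' modnMmr.
  apply: esym; rewrite mulnCA -modnMmr E modnMmr.
  by congr (_ %% _)%N; lia.
rewrite dvdzE /=; set D := `|_|%N.
set g := gcdn x1 m => mD.
have : (m %/ g * g %| x1 %/ g * g * D)%N by rewrite !divnK ?dvdn_gcdl ?dvdn_gcdr.
rewrite mulnAC dvdn_pmul2r // Gauss_dvdr // /coprime.
by rewrite -(eqn_pmul2r g0) muln_gcdl !divnK ?dvdn_gcdl ?dvdn_gcdr // mul1n gcdnC.
Qed.

Lemma card_fiber_le (m : nat) (I : finType) (v : I -> nat) (x1 x2 : nat) :
  (0 < m)%N -> injective v ->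
  (forall i, [/\ prime (v i), coprime (v i) m & (v i ^ 2 <= m)%N]) ->
  (#|[set p : 'I_m * (I * I) | [&& p.2.1 != p.2.2,
      (p.1 * v p.2.1 == x1 %[mod m])%N & (p.1 * v p.2.2 == x2 %[mod m])%N]]|
    <= 2 * gcdn x1 m)%N.
Proof.
move=> m0 vI hv; set A := [set p | _].
have vpr i : prime (v i) by case: (hv i).
have vco i : coprime m (v i) by rewrite coprime_sym; case: (hv i).
have v0 i : (0 < v i)%N by exact: prime_gt0.
have vvm i j : (v i * v j <= m)%N.
  have [_ _ hi] := hv i; have [_ _ hj] := hv j.
  by rewrite -leq_sqr expnMn -[(m ^ 2)%N]mulnn leq_mul.
have [A0|[p0 p0A]] := set_0Vmem A; first by rewrite A0 cards0.
case: (arg_maxnP (P := mem A) (fun p : 'I_m * (I * I) => v p.2.1) p0A).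
move=> -[t0 [a0 b0]] /= P0 maxP.
(* Distinct p have distinct D p: D p = D p' forces v a0 to divide the difference
   of two numbers in [1, v a0], by maximality of v a0. *)
set g := gcdn x1 m.
have g0 : (0 < g)%N by rewrite gcdn_gt0 m0 orbT.
pose q := (m %/ g)%N; have qg : (q * g = m)%N by rewrite divnK ?dvdn_gcdr.
pose D (p : 'I_m * (I * I)) := (v a0)%:Z * v p.2.2 - (v p.2.1)%:Z * v b0.
have qD p : p \in A -> (q %| D p)%Z.
  move: P0; rewrite !inE /= => /and3P[_ /eqP E1 /eqP E2] /and3P[_ /eqP F1 /eqP F2].
  (* For a triple [(t, a, b)] both sides of the congruence are [t * v a * v b] modulo [m]. *)
  apply: (@det_dvd m x1 x2) => //.
    by rewrite -modnMml -E1 modnMml -[RHS]modnMml -E2 modnMml; congr (_ %% _)%N; lia.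
  by rewrite -modnMml -F1 modnMml -[RHS]modnMml -F2 modnMml; congr (_ %% _)%N; lia.
(* [D p] is a difference of two numbers in [[1, m]], so its absolute value is below [m = q * g]. *)
have Dlt p : p \in A -> (`|(D p %/ q)%Z| < g)%N.
  move=> pA; rewrite -(ltn_pmul2r (_ : 0 < q)%N); last first.
    by rewrite divn_gt0 // dvdn_leq // dvdn_gcdr.
  have -> : (`|(D p %/ q)%Z| * q)%N = `|D p|%N by rewrite -(abszM _ q) divzK ?qD.
  rewrite mulnC qg /D.
  have : (0 < v a0 * v p.2.2 <= m)%N by rewrite muln_gt0 !v0 vvm.
  have : (0 < v p.2.1 * v b0 <= m)%N by rewrite muln_gt0 !v0 vvm.
  rewrite -!PoszM; move: (v a0 * v p.2.2)%N (v p.2.1 * v b0)%N => x y; lia.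
(* The quotients lie strictly between [-g] and [g]; adding [g] makes them naturals below [2 * g]. *)
pose f p : 'I_(2 * g).-1.+1 := inord `|((D p %/ q)%Z + g)%R|.
have fE p : p \in A -> (f p : nat) = `|((D p %/ q)%Z + g)%R|%N.
  by move=> /Dlt Dp; rewrite inordK //; lia.
have -> : (2 * g = (2 * g).-1.+1)%N by rewrite prednK // muln_gt0.
rewrite -[X in (_ <= X)%N]card_ord -(card_in_imset (f := f)); first exact: max_card.
move=> p p' pA p'A /(congr1 val) /=; rewrite !fE // => fpp'.
have : D p = D p'.
  rewrite -(divzK (qD _ pA)) -(divzK (qD _ p'A)); congr (_ * _).
  move: (Dlt _ pA) (Dlt _ p'A) fpp'.
  move: (D p %/ q)%Z (D p' %/ q)%Z => x x'; lia.
have vmax p1 : p1 \in A -> (0 < v p1.2.1 <= v a0)%N.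
  by move=> p1A; rewrite v0; exact: maxP.
have nab : v a0 != v b0.
  by move: P0; rewrite !inE /= => /andP[ab _]; rewrite (inj_eq vI).
case/(det_primes_inj _ _ _ _ _ _ (vpr a0) (vpr b0) nab (vmax _ pA) (vmax _ p'A)).
move=> /vI e1 /vI e2.
(* Once the primes agree, [t < m] is recovered by cancelling [v a], a unit modulo [m]. *)
have : p.1 = p'.1.
  move: pA p'A; rewrite !inE => /and3P[_ /eqP E1 _] /and3P[_ /eqP F1 _].
  apply/val_inj; rewrite /=.
  rewrite -[LHS](modn_small (ltn_ord p.1)) -[RHS](modn_small (ltn_ord p'.1)).
  by apply: (coprime_modMr_inj _ _ _ _ (vco p.2.1)); rewrite E1 e1 F1.
by case: p p' e1 e2 {fpp' pA p'A} => [t [a b]] [t' [a' b']] /= -> -> ->.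
Qed.

Lemma sum_mod_dist_pairs_le (R : realFieldType) (m : nat) (I : finType)
    (v : I -> nat) :
  (0 < m)%N -> injective v ->
  (forall i, [/\ prime (v i), coprime (v i) m & (v i ^ 2 <= m)%N]) ->
  \sum_(p : 'I_m * (I * I) | (0 < p.1)%N && (p.2.1 != p.2.2))
     ((mod_dist m (p.1 * v p.2.1))%:R^-1 * (mod_dist m (p.1 * v p.2.2))%:R^-1 : R)
  <= 8 * harmonic_sum R m ^+ 2 * (m%:R / (totient m)%:R).
Proof.
move=> m0 vI hv.
pose key (p : 'I_m * (I * I)) : 'I_m * 'I_m :=
  (Ordinal (ltn_pmod (p.1 * v p.2.1) m0), Ordinal (ltn_pmod (p.1 * v p.2.2) m0)).
(* Multiplying [t] by a unit modulo [m] keeps its gcd with [m], so both residues are nonzero with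
   the common gcd [gcdn t m]. *)
pose Q (k : 'I_m * 'I_m) := [&& (0 < k.1)%N, (0 < k.2)%N & gcdn k.1 m == gcdn k.2 m].
rewrite (partition_big key Q) => [|p /andP[p0 _]]; last first.
  have nd c : coprime c m -> ~~ (m %| p.1 * c)%N.
    move=> cm; rewrite Gauss_dvdl 1?coprime_sym //.
    by apply/negP => /(dvdn_leq p0); rewrite leqNgt ltn_ord.
  have [_ ca _] := hv p.2.1; have [_ cb _] := hv p.2.2.
  rewrite /Q /key /= !lt0n -!/(dvdn _ _) !nd //= !gcdn_modl.
  by rewrite ![gcdn _ m]gcdnC !Gauss_gcdl // coprime_sym.
pose w (x : nat) : R := (mod_dist m x)%:R^-1.
have w0 x : 0 <= w x by rewrite invr_ge0.
have fiber k :
  \sum_(p : 'I_m * (I * I) | ((0 < p.1)%N && (p.2.1 != p.2.2)) && (key p == k))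
     (w (p.1 * v p.2.1)%N * w (p.1 * v p.2.2)%N)
     <= (2 * gcdn k.1 m)%:R * (w k.1 * w k.2).
  rewrite (eq_bigr (fun=> w k.1 * w k.2)); last first.
    by move=> p /andP[_ /eqP <-]; rewrite /w !mod_dist_mod.
  rewrite sumr_const -[leLHS]mulr_natl ler_wpM2r ?mulr_ge0 // ler_nat.
  apply: leq_trans (card_fiber_le _ _ _ k.1 k.2 m0 vI hv).
  apply/subset_leq_card/fintype.subsetP => p; rewrite inE unfold_in.
  move=> /andP[/andP[_ ->] /eqP <-] /=.
  by rewrite !modn_mod !eqxx.
apply: le_trans; first by apply: ler_sum => k _; exact: fiber.
(* Here [m %/ e] plays the gcd. Asking only that it divide both residues makes the double sum a
   square. *)
pose T (e : nat) (x : 'I_m) := (0 < x)%N && (m %/ e %| x)%N.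
(* The term e = m / gcdn k.1 m already dominates. *)
apply: (@le_trans _ _ (\sum_(k : 'I_m * 'I_m) \sum_(e < m.+1 | (e %| m)%N)
   if T e k.1 && T e k.2 then (2 * (m %/ e))%:R * (w k.1 * w k.2) else 0)).
  have term0 (k : 'I_m * 'I_m) (e : 'I_m.+1) : (0 : R) <=
      if T e k.1 && T e k.2 then (2 * (m %/ e))%:R * (w k.1 * w k.2) else 0.
    by case: ifP => // _; rewrite !mulr_ge0.
  rewrite big_mkcond; apply: ler_sum => k _.
  case: ifP => [/and3P[k1 k2 /eqP gk]|_]; last exact: sumr_ge0.
  have gm := dvdn_gcdr k.1 m.
  have gg : (m %/ (m %/ gcdn k.1 m) = gcdn k.1 m)%N by rewrite divnA // mulKn.
  have lem : (m %/ gcdn k.1 m < m.+1)%N by rewrite ltnS leq_div.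
  rewrite (bigD1 (Ordinal lem)) /=; last by rewrite dvdn_div.
  rewrite /T k1 k2 gg dvdn_gcdl {2}gk dvdn_gcdl /= lerDl.
  by apply: sumr_ge0 => i _; case: ifP => // _; rewrite !mulr_ge0.
rewrite exchange_big /=.
have sumT (e : nat) :
    \sum_(x : 'I_m | T e x) w x = \sum_(1 <= x < m | (m %/ e %| x)%N) w x.
  rewrite -(big_mkord (fun x => (0 < x) && (m %/ e %| x))%N) big_mkcond big_ltn //=.
  rewrite add0r [RHS]big_mkcond big_nat_cond [RHS]big_nat_cond.
  by apply: eq_bigr => x /andP[/andP[->]].
apply: (@le_trans _ _ (\sum_(e < m.+1 | (e %| m)%N)
    (8 * harmonic_sum R m ^+ 2) * (e%:R / m%:R))); last first.
  rewrite -mulr_sumr ler_wpM2l ?sum_divisors_le //.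
  by rewrite mulr_ge0 ?sqr_ge0.
apply: ler_sum => e em.
rewrite -big_mkcond -mulr_sumr /=.
rewrite -(pair_big (fun x => T e x) (fun x => T e x) (fun x y : 'I_m => w x * w y)) /=.
have -> : \sum_(i < m | T e i) \sum_(j < m | T e j) w i * w j
  = (\sum_(i < m | T e i) w i) ^+ 2.
  by rewrite expr2 mulr_suml; apply: eq_bigr => i _; rewrite mulr_sumr.
have e0 : (0 < e)%N := dvdn_gt0 m0 em.
have d0 : (0 < m %/ e)%N by rewrite divn_gt0 // dvdn_leq.
have dm : (m %/ e %| m)%N by exact: dvdn_div.
have W0 : 0 <= \sum_(i < m | T e i) w i by exact: sumr_ge0.
move: (sum_inv_mod_dist_le R m (m %/ e) m0 dm); rewrite -sumT.
have -> : (e%:R / m%:R : R) = (m %/ e)%:R^-1.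
  by rewrite natf_div // invf_div.
have : (0 : R) < (m %/ e)%:R by rewrite ltr0n.
move: W0; rewrite natrM; move: (_ %/ _)%:R => D.
move: (harmonic_sum R m) (\sum_(i < m | T e i) w i) => H W W0 D0 WH.
(* Source of the 8: the fiber bound gives 2, each of the two residue sums gives [2 / D]. *)
apply: (@le_trans _ _ (2 * D * (2 / D * H) ^+ 2)).
  apply: ler_wpM2l; first by rewrite mulr_ge0 // ltW.
  by apply: lerXn2r => //; rewrite nnegrE // (le_trans W0).
by rewrite le_eqVlt; apply/predU1P; left; field; rewrite gt_eqF.
Qed.

(** * Lower bounds for [1 - w ^+ x] at a root of unity [w] *)

Lemma norm_1subX_le (C : numDomainType) (z : C) (k : nat) : `|z| = 1 ->
  `|1 - z ^+ k| <= k%:R * `|1 - z|.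
Proof.
move=> z1; rewrite distrC subrX1 normrM mulrC [X in _ * X]distrC.
rewrite ler_wpM2r ?normr_ge0 // (le_trans (ler_norm_sum _ _ _)) //.
rewrite (eq_bigr (fun=> 1)) => [|i _]; first by rewrite sumr_const card_ord.
by rewrite normrX z1 expr1n.
Qed.

Lemma cos_le0_left_half (R : realType) (x : R) :
  pi / 2 <= x <= 3 * pi / 2 -> cos x <= 0.
Proof.
move=> xb; rewrite -(subrK pi x) cosDpi oppr_le0 cos_ge0_pihalf //.
by have := pi_gt0 R; lra.
Qed.

Lemma complex_cos_sin_expr (R : realType) (x : R) (k : nat) :
  ((cos x +i* sin x) ^+ k = cos (x *+ k) +i* sin (x *+ k))%C.
Proof.
elim: k => [|k IH]; first by rewrite expr0 mulr0n cos0 sin0.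
rewrite exprS IH mulrS cosD sinD; simpc.
by congr (_ +i* _)%C; rewrite addrC.
Qed.

(** When [w ^+ x] lies in the left half-plane, it is at distance at least 1 from 1. Smaller [x] are
    multiplied into that range at the cost given by [norm_1subX_le], and larger ones are reflected
    to [m - x]. *)
Lemma mod_dist_norm_le (R : realType) (m : nat) : (0 < m)%N ->
  let w := (cos (2 * pi / m%:R) +i* sin (2 * pi / m%:R))%C : R[i] in
  w ^+ m = 1 /\ forall x, (mod_dist m x)%:R <= m%:R * `|1 - w ^+ x|.
Proof.
move=> m0 w.
have m0R : (0 : R) < m%:R by rewrite ltr0n.
have wX k : w ^+ k = (cos (2 * pi / m%:R *+ k) +i* sin (2 * pi / m%:R *+ k))%C.
  exact: complex_cos_sin_expr.
have wm : w ^+ m = 1.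
  rewrite wX -mulr_natr mulfVK ?gt_eqF // mulr_natl cos2pi sin2pi.
  by [].
split=> // x0.
have w1 : `|w| = 1.
  by apply/eqP; rewrite -(pexpr_eq1 m0) // -normrX wm normr1.
have wx1 x : `|w ^+ x| = 1 by rewrite normrX w1 expr1n.
have far x : (m <= 4 * x)%N -> (4 * x <= 3 * m)%N -> 1 <= `|1 - w ^+ x|.
  move=> xl xu; apply: le_trans (normc_ge_Re _).
  rewrite -[1](rmorph1 (real_complex R)) lecR wX /=.
  have : cos (2 * pi / m%:R *+ x) <= 0 :> R.
    apply: cos_le0_left_half; rewrite -[_ *+ x]mulr_natr.
    have := pi_gt0 R.
    have xl' : (m%:R <= 4 * x%:R :> R) by rewrite -natrM ler_nat.
    have xu' : (4 * x%:R <= 3 * m%:R :> R) by rewrite -!natrM ler_nat.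
    move=> /ltW p0; rewrite mulrAC ler_pdivlMr // ler_pdivrMr //.
    have := ler_wpM2l p0 xl'; have := ler_wpM2l p0 xu'.
    by move: (pi : R) p0 (x%:R) (m%:R) => *; apply/andP; split; lra.
  by move=> c0; apply: le_trans (ler_norm _); rewrite lerBrDl gerDr.
(* Multiplying x by a suitable k moves it to [m/4, 3m/4], where far applies. *)
have half x : (0 < x)%N -> (2 * x <= m)%N -> x%:R <= m%:R * `|1 - w ^+ x|.
  (* This [k] gives [m/4 < x * k <= m/4 + x <= 3m/4]. *)
  move=> x1 xm; pose k := (m %/ (4 * x)).+1.
  have kl : (m <= 4 * (x * k))%N.
    by rewrite mulnA ltnW // mulnC ltn_ceil // muln_gt0.
  have ku : (4 * (x * k) <= 3 * m)%N.
    rewrite mulnA mulnS mulnC; have := leq_divM m (4 * x); lia.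
  have := far _ kl ku; rewrite exprM => /le_trans.
  move/(_ _ (norm_1subX_le _ _ k (wx1 x))) => h.
  rewrite -(ler_pM2l (_ : 0 < x%:R)) ?ltr0n // in h.
  rewrite mulr1 in h; apply: le_trans h _.
  rewrite mulrA ler_wpM2r ?normr_ge0 // -natrM ler_nat; lia.
rewrite -mod_dist_mod -(expr_mod x0 wm); move: (ltn_pmod x0 m0).
move: (x0 %% m)%N => x xm; rewrite /mod_dist modn_small //.
case: (posnP x) => [->|x1]; first by rewrite min0n mulr_ge0.
case: (leqP (2 * x) m) => [h|h].
  by have := half x x1 h; have -> : minn x (m - x) = x by lia.
have -> : minn x (m - x) = (m - x)%N by lia.
have -> : `|1 - w ^+ x| = `|1 - w ^+ (m - x)|; last by apply: half; lia.
transitivity (`|w ^+ (m - x)| * `|1 - w ^+ x|); first by rewrite wx1 mul1r.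
rewrite -normrM mulrBr mulr1 -exprD subnK ?(ltnW xm) //.
by rewrite wm distrC.
Qed.

(** Primitivity follows from the lower bound: if [w] has order [k], then [w ^+ k = 1] forces
    [mod_dist m k = 0], so [m] divides [k]. *)
Lemma exists_prim_root_norm (R : realType) (m : nat) : (0 < m)%N ->
  exists w : R[i], m.-primitive_root w /\
    forall x, (mod_dist m x)%:R <= m%:R * `|1 - w ^+ x|.
Proof.
move=> m0; have [] := mod_dist_norm_le R m m0; set w := (_ +i* _)%C => wm wx.
exists w; split=> //.
have [k wk km] := prim_order_exists m0 wm.
suff -> : m = k by [].
apply/eqP; rewrite eqn_dvd km andbT; apply/negPn; rewrite -mod_dist_gt0 // -leqNgt.
by have := wx k; rewrite (prim_expr_order wk) subrr normr0 mulr0 lern0 => /eqP ->.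
Qed.

(** * Counting congruent pairs by exponential sums *)

Lemma sum_expr_unity_root (F : fieldType) (m : nat) (z : F) : z ^+ m = 1 ->
  \sum_(t < m) z ^+ t = if z == 1 then m%:R else 0.
Proof.
move=> zm; case: eqVneq => [->|z1].
  by rewrite (eq_bigr (fun=> 1)) => [|i _]; rewrite ?expr1n // sumr_const card_ord.
have /eqP := subrX1 z m; rewrite zm subrr eq_sym mulf_eq0 subr_eq0 (negPf z1) /=.
by move/eqP.
Qed.

Lemma norm_geometric_sum_le (C : numDomainType) (z : C) (s l : nat) : `|z| = 1 ->
  `|\sum_(i < l) z ^+ (s + i)| * `|1 - z| <= 2.
Proof.
move=> z1; rewrite (eq_bigr (fun i : 'I_l => z ^+ s * z ^+ i)); last first.
  by move=> i _; rewrite exprD.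
rewrite -mulr_sumr normrM normrX z1 expr1n mul1r mulrC distrC -normrM -subrX1.
by rewrite (le_trans (ler_normB _ _)) // normrX z1 expr1n normr1.
Qed.

(** The unknowns are [s + i] and [s + j]; [s] will be the residue of [S + 1], so that only naturals
    occur. *)
Definition nb_congruent_pairs (m s l a b : nat) : nat :=
  #|[set p : 'I_l * 'I_l | a * (s + p.1) == b * (s + p.2) %[mod m]]|%N.

(** Orthogonality of additive characters: for fixed [y1], [y2], the sum over [t] of
    [w ^+ (t * (a * y1 - b * y2))] is [m] if the congruence holds and 0 otherwise. *)
Lemma nb_congruent_pairsE (C : fieldType) (m s l a b : nat) (w : C) :
  m.-primitive_root w ->
  m%:R * (nb_congruent_pairs m s l a b)%:R =
  \sum_(t < m) (\sum_(i < l) (w ^+ (t * a)) ^+ (s + i)) *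
               (\sum_(j < l) (w ^- (t * b)) ^+ (s + j)).
Proof.
move=> wp; have m0 := prim_order_gt0 wp.
have w0 n : w ^+ n != 0.
  apply: expf_neq0; apply/eqP => w0; have /esym/eqP := prim_expr_order wp.
  by rewrite w0 expr0n gtn_eqF // oner_eq0.
under [RHS]eq_bigr => t _ do rewrite big_distrlr /= pair_big /=.
rewrite exchange_big /= /nb_congruent_pairs cardsE -sumr_const mulr_sumr big_mkcond /=.
apply: eq_bigr => p _.
rewrite (eq_bigr (fun t : 'I_m =>
   (w ^+ (a * (s + p.1)) / w ^+ (b * (s + p.2))) ^+ t)); last first.
  move=> t _; rewrite exprMn !exprVn -!exprM.
  by congr (w ^+ _ / w ^+ _); lia.
rewrite sum_expr_unity_root; last first.
  by rewrite exprMn exprVn !(exprAC _ _ m) (prim_expr_order wp) !expr1n divr1.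
rewrite (can2_eq (divfK (w0 _)) (mulfK (w0 _))) mul1r.
by rewrite (eq_prim_root_expr wp) mulr1.
Qed.

(** The frequency [t = 0] yields [l ^+ 2]. For other [t] each geometric sum is at most 2 over its
    distance from ratio to 1, hence at most [2 * m] over [mod_dist]; dividing the product by [m]
    gives [4 * m]. *)
Lemma nb_congruent_pairs_le (R : realType) (m s l a b : nat) : (0 < m)%N ->
  coprime a m -> coprime b m ->
  `|(nb_congruent_pairs m s l a b)%:R - l%:R ^+ 2 / m%:R : R| <=
  4 * m%:R * \sum_(t < m | (0 < t)%N)
     ((mod_dist m (t * a))%:R^-1 * (mod_dist m (t * b))%:R^-1).
Proof.
move=> m0 ca cb; have [w [wp wd]] := exists_prim_root_norm R m m0.
have m0R : (0 : R) < m%:R by rewrite ltr0n.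
have w1 n : `|w ^+ n| = 1.
  apply/eqP; rewrite -(pexpr_eq1 m0) // -normrX exprAC (prim_expr_order wp).
  by rewrite expr1n normr1.
have sum_le z x : `|z| = 1 -> `|1 - z| = `|1 - w ^+ x| -> (0 < mod_dist m x)%N ->
    `|\sum_(i < l) z ^+ (s + i)| <= (2 * m%:R / (mod_dist m x)%:R : R)%:C%C.
  move=> z1 zx d0; have := norm_geometric_sum_le _ z s l z1.
  rewrite zx; move: `|\sum_(i < l) _| (normr_ge0 (\sum_(i < l) z ^+ (s + i))) => S S0 h.
  have d0' : (0 : R[i]) < (mod_dist m x)%:R by rewrite ltr0n.
  rewrite fmorph_div rmorphM /= !rmorph_nat ler_pdivlMr //.
  apply: le_trans (ler_wpM2l S0 (wd x)) _.
  by rewrite mulrCA [leRHS]mulrC ler_wpM2l.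
have dist0 (t : 'I_m) c : coprime c m -> (0 < t)%N -> (0 < mod_dist m (t * c))%N.
  move=> cm t0; rewrite mod_dist_gt0 // Gauss_dvdl 1?coprime_sym //.
  by apply/negP => /(dvdn_leq t0); rewrite leqNgt ltn_ord.
set N := nb_congruent_pairs _ _ _ _ _; set W := \sum_(t < m | _) _.
have key : `|m%:R * N%:R - l%:R ^+ 2| <= 4 * m%:R ^+ 2 * W.
  (* The real inequality is moved to [R[i]], where the character sums live. *)
  have -> : `|m%:R * N%:R - l%:R ^+ 2| <= 4 * m%:R ^+ 2 * W =
      (`|m%:R * N%:R - l%:R ^+ 2| <= (4 * m%:R ^+ 2 * W)%:C%C :> R[i]).
    rewrite -[m%:R * _ - _ in RHS](_ : (m%:R * N%:R - l%:R ^+ 2 : R)%:C%C = _).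
      by rewrite normc_def /= expr0n addr0 sqrtr_sqr lecR.
    by rewrite rmorphB rmorphM rmorphXn /= !rmorph_nat.
  rewrite (nb_congruent_pairsE _ _ _ _ _ _ _ wp).
  rewrite (bigD1 (Ordinal m0)) //= !mul0n expr0 invr1.
  have -> : \sum_(i < l) 1 ^+ (s + i) = l%:R :> R[i].
    by rewrite (eq_bigr (fun=> 1)) => [|i _]; rewrite ?expr1n // sumr_const card_ord.
  rewrite -expr2 addrAC subrr add0r (le_trans (ler_norm_sum _ _ _)) //.
  rewrite mulr_sumr rmorph_sum /= (eq_bigl (fun t : 'I_m => 0 < t)%N); last first.
    by move=> t; rewrite lt0n -val_eqE.
  apply: ler_sum => t t0; rewrite normrM.
  have -> : 4 * m%:R ^+ 2 * ((mod_dist m (t * a))%:R^-1 * (mod_dist m (t * b))%:R^-1)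
     = (2 * m%:R / (mod_dist m (t * a))%:R) * (2 * m%:R / (mod_dist m (t * b))%:R) :> R.
    by field; rewrite !pnatr_eq0 -!lt0n !dist0.
  rewrite rmorphM /= ler_pM ?sum_le ?dist0 //.
    by rewrite normrV ?w1 ?invr1 // unitfE -normr_gt0 w1.
  (* An inverse on the unit circle is as far from 1 as the number itself. *)
  have wt0 : w ^+ (t * b) != 0 by rewrite -normr_gt0 w1.
  transitivity (`|w ^+ (t * b)| * `|1 - w ^- (t * b)|); first by rewrite w1 mul1r.
  by rewrite -normrM mulrBr mulr1 divff // distrC.
rewrite -(ler_pM2l m0R); apply: le_trans (le_trans _ key) _.
  rewrite -{1}(gtr0_norm m0R) -normrM mulrBr [X in _ - X]mulrC divfK //.
  by rewrite gt_eqF.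
by rewrite le_eqVlt; apply/predU1P; left; ring.
Qed.

(** The unit [a] cancels, and at most [m] consecutive integers are pairwise incongruent. *)
Lemma nb_congruent_pairs_diag (m s l a : nat) : coprime a m -> (l <= m)%N ->
  nb_congruent_pairs m s l a a = l.
Proof.
move=> am lm; rewrite /nb_congruent_pairs -[RHS]card_ord.
rewrite -(card_imset (f := fun i : 'I_l => (i, i))) => [|i j [] //].
apply: eq_card => -[i j]; rewrite inE /=; apply/eqP/imsetP => [E|[k _ [-> ->]] //].
exists i => //; congr pair; apply/val_inj => /=.
have /eqP : s + i = s + j %[mod m].
  by apply: (coprime_modMr_inj _ a); rewrite 1?coprime_sym // mulnC E mulnC.
by rewrite eqn_modDl !modn_small ?(leq_trans (ltn_ord _) lm) // => /eqP.
Qed.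

(** * Splitting the solution count over pairs from [V] *)

(** Writing [y = S + 1 + i] with [i < l] parametrises the solutions injectively, and the congruence
    sees [S + 1] only through its residue. *)
Lemma nb_solutionsE (m : nat) (V : {fset nat}) (S : int) (l : nat) : (0 < m)%N ->
  nb_solutions m V S l = (\sum_(p : V * V)
    nb_congruent_pairs m `|((S + 1) %% m)%Z|%N l (val p.1) (val p.2))%N.
Proof.
move=> m0; set s := `|_|%N.
have sE : s%:Z = ((S + 1) %% m)%Z by rewrite gez0_abs // modz_ge0 // -lt0n.
have cong (c1 c2 : nat) (i j : 'I_l) :
    (c1 * (s + i) == c2 * (s + j) %[mod m])%N =
    (c1%:Z * (S + 1 + i) == c2%:Z * (S + 1 + j) %[mod m])%Z.
  rewrite -eqz_nat -!modz_nat !PoszM !PoszD sE.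
  by rewrite -(modzMmr c1) modzDml modzMmr -(modzMmr c2) modzDml modzMmr.
pose F (p : (V * V) * ('I_l * 'I_l)) : nat * nat * int * int :=
  (val p.1.1, val p.1.2, S + 1 + p.2.1%:Z, S + 1 + p.2.2%:Z).
have FI : injective F.
  by move=> [[a b] [i j]] [[a' b'] [i' j']] [] /val_inj -> /val_inj -> /addrI []
    /val_inj -> /addrI [] /val_inj ->.
pose P := [pred p : (V * V) * ('I_l * 'I_l) |
  (val p.1.1 * (s + p.2.1) == val p.1.2 * (s + p.2.2) %[mod m])%N].
have solE : solutions m V S l = [set` [fset F p | p in P]%fset]%classic.
  apply/seteqP; split => [[[[c1 c2] y1] y2] [c1V c2V y1b y2b E]|
      x /imfsetP[[[a b] [i j]] pP ->]].
    have i1 : (`|(y1 - (S + 1))%R|%N < l)%N by lia.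
    have i2 : (`|(y2 - (S + 1))%R|%N < l)%N by lia.
    apply/imfsetP; exists ((FSetSub c1V, FSetSub c2V), (Ordinal i1, Ordinal i2)).
      rewrite inE cong /= !gez0_abs; [|lia|lia].
      by rewrite !subrKC E.
    by rewrite /F /= !gez0_abs ?subrKC //; lia.
  rewrite /solutions /F /=; split; try exact: valP.
  - by have := ltn_ord i; lia.
  - by have := ltn_ord j; lia.
  - by apply/eqP; rewrite -cong.
rewrite /nb_solutions solE set_fsetK card_imfset //= -cardE.
rewrite -sum1_card (eq_bigl (fun p => predT p.1 && P p)) //.
rewrite -(pair_big_dep predT (fun a b => P (a, b)) (fun _ _ => 1%N)) /=.
apply: eq_bigr => p _; rewrite sum1_card /nb_congruent_pairs.
by apply: eq_card => q; rewrite !inE.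
Qed.

(** * Logarithmic bounds and the final estimate *)

(** Induction, using [ln (1 + x) <= x] at [x = - 1 / (n + 2)]. *)
Lemma harmonic_sum_le_ln (R : realType) (n : nat) :
  harmonic_sum R n.+1 <= 1 + ln n.+1%:R.
Proof.
rewrite /harmonic_sum; elim: n => [|n IH]; first by rewrite big_nat1 ln1 invr1 addr0.
rewrite big_nat_recr //=.
have n1 : (0 : R) < n.+1%:R by rewrite ltr0n.
have n2 : (0 : R) < n.+2%:R by rewrite ltr0n.
have nE : n.+2%:R = n.+1%:R + 1 :> R by rewrite -natr1.
have : ln (n.+1%:R / n.+2%:R) <= - n.+2%:R^-1 :> R.
  have -> : n.+1%:R / n.+2%:R = 1 + - n.+2%:R^-1 :> R.
    have -> : n.+1%:R = n.+2%:R - 1 :> R by rewrite nE addrK.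
    by rewrite mulrBl divff ?gt_eqF // mul1r.
  by apply: le_ln1Dx; rewrite ltrNl opprK invf_lt1 // nE ltrDr.
rewrite ln_div ?posrE //; move: IH.
by move: (ln _) (ln _) (n.+2%:R^-1) (\sum_(_ <= _ < _) _) => *; lra.
Qed.

Lemma harmonic_sum_le (R : realType) (m : nat) : (1 < m)%N ->
  harmonic_sum R m <= 3 * ln m%:R.
Proof.
case: m => // m m1; apply: le_trans (harmonic_sum_le_ln R m) _.
(* The 1 is absorbed since [ln m >= ln 2 >= 1/2], from [ln (1 - 1/2) <= - 1/2]. *)
have : 2^-1 <= ln m.+1%:R :> R; last by lra.
apply: (@le_trans _ _ (ln 2)); last by rewrite ler_ln ?posrE ?ltr0n // ler_nat.
have := @le_ln1Dx R (- 2^-1).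
have -> : 1 + - 2^-1 = 2^-1 :> R by lra.
by rewrite lnV ?posrE //; lra.
Qed.

Theorem theorem1 (R : realType) :
  exists C : R, 0 < C /\
    forall (m : nat) (V : {fset nat}) (S L : int),
      (0 < m)%N ->
      (forall v : nat, v \in V ->
         [/\ prime v, coprime v m & v%:R <= Num.sqrt (m%:R : R)]) ->
      0 < L <= m%:Z ->
      `| (nb_solutions m V S L)%:R
         - ((#|` V|%fset)%:R ^+ 2 * L%:~R ^+ 2 / m%:R
            + (#|` V|%fset)%:R * L%:~R
            - (#|` V|%fset)%:R * L%:~R ^+ 2 / m%:R) |
      <= C * (m%:R ^+ 2 * ln m%:R ^+ 2 / (totient m)%:R).
Proof.
(* [288 = 4 * 8 * 3 ^ 2]: the factors come from [nb_congruent_pairs_le], [sum_mod_dist_pairs_le] and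
   the squared [harmonic_sum_le]. *)
exists 288; split=> // m V S L m0 hV.
case: L => // l /andP[_]; rewrite lez_nat => lm.
have hv (i : V) : [/\ prime (val i), coprime (val i) m & (val i ^ 2 <= m)%N].
  have [pi ci si] := hV _ (valP i); split=> //.
  by rewrite -(ler_nat R) natrX -[leRHS](@sqr_sqrtr R) // lerXn2r ?nnegrE.
have m_gt1 (i : V) : (1 < m)%N.
  by have [/prime_gt1 i1 _ im] := hv i; move: i1 im => /=; nia.
rewrite nb_solutionsE // natr_sum.
set s := `|_|%N; set n := #|` V|%fset.
have nE : n = #|{: V}| by rewrite /n cardfE.
(* The main term, pair by pair: [n] diagonal pairs give [l], the other [n * (n - 1)] give
   [l ^+ 2 / m]. *)
pose M (a b : V) : R := if a == b then l%:R else l%:R ^+ 2 / m%:R.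
have -> : n%:R ^+ 2 * l%:R ^+ 2 / m%:R + n%:R * l%:R - n%:R * l%:R ^+ 2 / m%:R
    = \sum_(p : V * V) M p.1 p.2.
  rewrite -(pair_big predT predT (fun a b => M a b)) /=.
  rewrite (eq_bigr (fun=> l%:R + (n%:R - 1) * (l%:R ^+ 2 / m%:R))); last first.
    move=> a _; rewrite (bigD1 a) //= {1}/M eqxx; congr (_ + _).
    rewrite (eq_bigr (fun=> l%:R ^+ 2 / m%:R)); last first.
      by move=> b /negPf ba; rewrite /M eq_sym ba.
    rewrite sumr_const -[LHS]mulr_natl; congr (_ * _).
    have n0 : (0 < n)%N by rewrite nE; apply/card_gt0P; exists a.
    by rewrite (eq_card (B := predC1 a)) // cardC1 -nE -{2}(prednK n0) -natr1 addrK.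
  by rewrite sumr_const -nE -[RHS]mulr_natl; ring.
rewrite -sumrB; apply: le_trans (ler_norm_sum _ _ _) _.
rewrite (bigID (fun p : V * V => p.1 == p.2)) /= big1 ?add0r; last first.
  move=> p /eqP <-; have [_ ca _] := hv p.1.
  by rewrite nb_congruent_pairs_diag // /M eqxx subrr normr0.
pose W t (p : V * V) : R :=
  (mod_dist m (t * val p.1))%:R^-1 * (mod_dist m (t * val p.2))%:R^-1.
apply: (@le_trans _ _ (\sum_(p : V * V | p.1 != p.2) 4 * m%:R *
    \sum_(t < m | (0 < t)%N) W t p)).
  apply: ler_sum => p /negPf pn; rewrite /M pn.
  have [_ ca _] := hv p.1; have [_ cb _] := hv p.2.
  exact: nb_congruent_pairs_le.
rewrite -mulr_sumr exchange_big /= pair_big_dep /=.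
have lnm0 : 0 <= ln m%:R :> R by rewrite ln_ge0 // ler1n.
(* For [m = 1] the set [V] is empty, so the error sum vanishes. *)
case: (ltnP 1 m) => [m1|m_le1]; last first.
  rewrite big1 ?mulr0; last by move=> -[t [a b]] _; have := m_gt1 a; rewrite ltnNge m_le1.
  by rewrite mulr_ge0 // divr_ge0 // mulr_ge0 // sqr_ge0.
have wle := sum_mod_dist_pairs_le R m V val m0 val_inj hv.
apply: (@le_trans _ _ (4 * m%:R * (8 * (3 * ln m%:R) ^+ 2 * (m%:R / (totient m)%:R)))).
  rewrite ler_wpM2l // (le_trans wle) // ler_wpM2r ?divr_ge0 // ler_wpM2l //.
  have H0 : 0 <= harmonic_sum R m by apply: sumr_ge0 => j _; rewrite invr_ge0.
  by apply: lerXn2r (harmonic_sum_le R m m1) => //; rewrite nnegrE // mulr_ge0.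
rewrite le_eqVlt; apply/predU1P; left; field.
by rewrite pnatr_eq0 -lt0n totient_gt0.
Qed.
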